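(* Let $m>n\ge 1$ be integers, $A\in\mathbb{R}^{m\times n}$, $b\in\mathbb{R}^m$ and $\lambda>0$ a real number. Let $\hat\sigma_n$ be the smallest singular value of $A$ and $\sigma_{n+1}$ the smallest singular value of $[A\;\ \lambda b]\in\mathbb{R}^{m\times(n+1)}$, and assume $\hat\sigma_n>\sigma_{n+1}$. Put $M=A^TA-\sigma_{n+1}^2I_n$, let $x_S=M^{-1}A^Tb$ be the solution of the scaled total least squares (STLS) problem, let $r=Ax_S-b$, and assume $r\neq 0$. Then the absolute condition number $\kappa_F(A,\lambda b)=\|K\|_2$ of the STLS problem, where $$K=M^{-1}\left(\left(\frac{2}{\|r\|_2^2}A^Trr^T-A^T\right)\left(\begin{bmatrix}x_S^T & -1\end{bmatrix}\otimes I_m\right)-\begin{bmatrix}I_n\otimes r^T & 0_{n\times m}\end{bmatrix}\right)\in\mathbb{R}^{n\times m(n+1)},$$ has the following two equivalent forms, that is, $\kappa_F(A,\lambda b)=\kappa_{F1}(A,\lambda b)=\kappa_{F2}(A,\lambda b)$, where $$\kappa_{F1}(A,\lambda b)=\left\|M^{-1}\left((1+\|x_S\|_2^2)A^TA-A^Trx_S^T-x_Sr^TA+\|r\|_2^2I_n\right)M^{-1}\right\|_2^{1/2}$$ and $$\kappa_{F2}(A,\lambda b)=\left\|M^{-1}\begin{bmatrix}A^T & \|x_S\|_2A^T\left(I_m-\frac{1}{\|r\|_2^2}rr^T\right) & \|r\|_2\left(I_n-\frac{1}{\|r\|_2^2}A^Trx_S^T\right)\end{bmatrix}\right\|_2.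$$
   Context: $\|\cdot\|_2$ is the spectral norm of a matrix or the Euclidean norm of a vector, $\|\cdot\|_F$ is the Frobenius norm, $I_k$ is the $k\times k$ identity matrix, and $0_{p\times q}$ is the $p\times q$ zero matrix. For matrices $P=[p_{ij}]$ and $Q$, $P\otimes Q=[p_{ij}Q]$ is the Kronecker product. $\mathrm{vec}(\cdot)$ stacks the columns of a matrix into one column vector. The STLS problem is: minimize $\|[E\;\ r']\|_F$ over $E\in\mathbb{R}^{m\times n}$, $r'\in\mathbb{R}^m$ subject to $\lambda b-r'\in\mathcal{R}(A+E)$, where $\mathcal{R}(\cdot)$ is the range. If $[E_S\;\ r_S]$ is the minimizer, the STLS solution is the solution $x_S$ of $(A+E_S)\lambda x=\lambda b-r_S$. Under the condition $\hat\sigma_n>\sigma_{n+1}$, the problem has a unique solution, $M$ is positive definite, and $x_S=M^{-1}A^Tb$. The absolute (normwise) condition number of the STLS problem is $\kappa_F(A,\lambda b)=\|K\|_2$, where $K$ (the matrix displayed in the claim) is the matrix of the first-order change of the solution under perturbations: if $x_{PS}$ is the STLS solution for the data $A+\Delta A$, $b+\Delta b$ (same $\lambda$), then $x_{PS}-x_S=K\begin{bmatrix}\mathrm{vec}(\Delta A)\\ \Delta b\end{bmatrix}+\mathcal{O}(\|[\Delta A,\Delta b]\|_F^2)$. *)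

(* Defs.v *)
From mathcomp Require Import all_boot all_order all_algebra.
From mathcomp Require Import all_classical all_reals.
From mathcomp Require Import mxtens.

Set Implicit Arguments.
Unset Strict Implicit.
Unset Printing Implicit Defensive.

Import Order.TTheory GRing.Theory Num.Theory.
Local Open Scope classical_set_scope.
Local Open Scope ring_scope.

Definition enorm (R : realType) (n : nat) (x : 'cV[R]_n) : R :=
  Num.sqrt (\sum_(i < n) x i 0 ^+ 2).

(* The unit ball, rather than the unit sphere, keeps the set nonempty when
   q = 0. *)
Definition specnorm (R : realType) (p q : nat) (B : 'M[R]_(p, q)) : R :=
  sup [set enorm (B *m x) | x in [set x : 'cV[R]_q | enorm x <= 1]].

(* Right convention only for tall matrices (q <= p), which have q singular
   values; for q > p it would also count the zeros coming from the kernel. *)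
Definition singular_value (R : realType) (p q : nat) (B : 'M[R]_(p, q))
    (s : R) : Prop :=
  0 <= s /\ eigenvalue (B^T *m B) (s ^+ 2).

(* There are finitely many singular values, and at least one if 0 < q, so this
   infimum is then a minimum. *)
Definition min_singular_value (R : realType) (p q : nat) (B : 'M[R]_(p, q)) :
    R :=
  inf [set s : R | singular_value B s].

Section STLS.
Context (R : realType) (m n : nat).
Context (A : 'M[R]_(m, n)) (b : 'cV[R]_m) (lambda : R).

Definition stls_sigma : R := min_singular_value (row_mx A (lambda *: b)).

Definition stls_M : 'M[R]_n := A^T *m A - (stls_sigma ^+ 2)%:M.

(* Closed form of the unique solution of the STLS problem, which it is when
   the smallest singular value of A exceeds stls_sigma. *)
Definition stls_sol : 'cV[R]_n := invmx stls_M *m A^T *m b.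

Definition stls_res : 'cV[R]_m := A *m stls_sol - b.

Local Notation M := stls_M.
Local Notation x := stls_sol.
Local Notation r := stls_res.

(* The Kronecker product *t produces the dimensions 1 * m, (n + 1) * m and
   n * 1; the casts only identify them with m, n * m + m and n. Columns are
   ordered as the entries of vec(Delta A) followed by those of Delta b. *)
Definition stls_dim : ((n + 1) * m = n * m + m)%N :=
  etrans (mulnDl n 1 m) (congr1 (addn (n * m)) (mul1n m)).

Definition stls_K : 'M[R]_(n, n * m + m) :=
  invmx M *m
    (((2 / enorm r ^+ 2) *: (A^T *m r *m r^T) - A^T)
       *m castmx (mul1n m, stls_dim)
            (row_mx x^T (-1)%:M *t (1%:M : 'M[R]_m))
     - row_mx (castmx (muln1 n, erefl (n * m)%N) ((1%:M : 'M[R]_n) *t r^T))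
              (0 : 'M[R]_(n, m))).

(* The solution changes by stls_K *m (vec(Delta A); Delta b) to first order, so
   this is the absolute normwise condition number. *)
Definition kappaF : R := specnorm stls_K.

Definition kappaF1 : R :=
  Num.sqrt (specnorm
    (invmx M
     *m ((1 + enorm x ^+ 2) *: (A^T *m A) - A^T *m r *m x^T - x *m r^T *m A
         + (enorm r ^+ 2)%:M)
     *m invmx M)).

Definition kappaF2 : R :=
  specnorm
    (invmx M
     *m row_mx A^T
          (row_mx
             (enorm x *: (A^T *m (1%:M - (enorm r ^+ 2)^-1 *: (r *m r^T))))
             (enorm r *: (1%:M - (enorm r ^+ 2)^-1 *: (A^T *m r *m x^T))))).

End STLS.

(* Main.v *)
Require Import Defs.
From mathcomp Require Import all_boot all_order all_algebra.
From mathcomp Require Import all_classical all_reals.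
From mathcomp Require Import mxtens ring.
Local Open Scope ring_scope.

(** The three numbers are spectral norms attached to one and the same Gram
    matrix.

    For every real matrix [B] the C*-identity says that the square of the
    spectral norm of [B] is the spectral norm of [B *m B^T]
    ([specnorm_gram]).  So the norm of [B] depends on [B *m B^T] only, and it is
    enough to multiply out the Gram matrices of the two block matrices, writing
    [W] for the inverse of [M] and [H] for the middle factor of [kappaF1].

    In the sensitivity matrix, [2 / |r|^2 A^T r r^T - A^T] is [- A^T] times the
    Householder reflection [Q = 1 - 2 r r^T / |r|^2].  As [Q] is orthogonal it
    disappears from the quadratic term, which is therefore
    [(1 + |x|^2) A^T A]; as [Q r = - r], the cross terms are
    [- A^T r x^T] and its transpose; the term with the Kronecker product
    [I (x) r^T] contributes [|r|^2 I].  The sum is [H] ([sensitivity_gram]).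

    In the matrix of [kappaF2], [1 - r r^T / |r|^2] is an orthogonal projection,
    so the second block contributes
    [|x|^2 A^T A - |x|^2 / |r|^2 A^T r r^T A], and the rank one
    correction is exactly compensated by the quadratic term of the third block
    ([projected_gram]).  Both Gram matrices are thus [W H W^T], and [W] is
    symmetric because [M] is. *)

Set Implicit Arguments.
Unset Strict Implicit.
Unset Printing Implicit Defensive.

Import Order.TTheory GRing.Theory Num.Theory.
Local Open Scope classical_set_scope.

(** * The Euclidean norm and the spectral norm *)

Section Norms.
Context (R : realType).

Lemma enorm_ge0 n (x : 'cV[R]_n) : 0 <= enorm x.
Proof. exact: sqrtr_ge0. Qed.

Lemma enorm_sqr n (x : 'cV[R]_n) : enorm x ^+ 2 = \sum_i x i 0 ^+ 2.
Proof. by rewrite sqr_sqrtr // sumr_ge0 // => i _; exact: sqr_ge0. Qed.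

Lemma mul_tr_self n (x : 'cV[R]_n) : x^T *m x = (enorm x ^+ 2)%:M.
Proof.
rewrite [LHS]mx11_scalar enorm_sqr mxE; congr (_%:M).
by apply: eq_bigr => i _; rewrite mxE expr2.
Qed.

Lemma enorm_eq0 n (x : 'cV[R]_n) : (enorm x == 0) = (x == 0).
Proof.
rewrite -sqrf_eq0 enorm_sqr; apply/idP/eqP => [|->].
  rewrite psumr_eq0 => [/allP x0|i _]; last exact: sqr_ge0.
  apply/colP => i; apply/eqP; rewrite mxE -sqrf_eq0.
  exact: x0 (mem_index_enum i).
by rewrite big1 // => i _; rewrite mxE expr0n.
Qed.

Lemma enorm0 n : enorm (0 : 'cV[R]_n) = 0.
Proof. by apply/eqP; rewrite enorm_eq0. Qed.

Lemma enormZ n (a : R) (x : 'cV[R]_n) : enorm (a *: x) = `|a| * enorm x.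
Proof.
rewrite -sqrtr_sqr -sqrtrM ?sqr_ge0 // mulr_sumr; congr Num.sqrt.
by apply: eq_bigr => i _; rewrite mxE exprMn.
Qed.

Lemma enorm_sqr_dot n (x : 'cV[R]_n) : enorm x ^+ 2 = (x^T *m x) 0 0.
Proof. by rewrite mul_tr_self mxE eqxx mulr1n. Qed.

(** The vector [|y|^2 x - <x, y> y] has square norm
    [|y|^2 (|x|^2 |y|^2 - <x, y>^2)], so the second factor is nonnegative
    when [y] is nonzero. *)
Lemma dot_le_enormM n (x y : 'cV[R]_n) : (x^T *m y) 0 0 <= enorm x * enorm y.
Proof.
apply: le_trans (ler_norm _) _.
rewrite -[leRHS]ger0_norm ?mulr_ge0 ?enorm_ge0 // -ler_sqr ?nnegrE //.
rewrite -!normrX !ger0_norm ?sqr_ge0 // exprMn.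
have [->|y0] := eqVneq y 0.
  by rewrite mulmx0 mxE expr0n mulr_ge0 ?sqr_ge0.
have y2_gt0 : 0 < enorm y ^+ 2.
  by rewrite exprn_gt0 // lt_neqAle enorm_ge0 eq_sym enorm_eq0 y0.
have := sqr_ge0 (enorm (enorm y ^+ 2 *: x - (x^T *m y) 0 0 *: y)).
have -> (a c : R) : enorm (a *: x - c *: y) ^+ 2
    = a ^+ 2 * enorm x ^+ 2 - 2 * a * c * (x^T *m y) 0 0
      + c ^+ 2 * enorm y ^+ 2.
  rewrite !enorm_sqr mxE !mulr_sumr -sumrB -big_split /=.
  by apply: eq_bigr => i _; rewrite !mxE; ring.
set c := (x^T *m y) 0 0; set d := enorm y ^+ 2 in y2_gt0 *.
rewrite (_ : _ + _ = d * (enorm x ^+ 2 * d - c ^+ 2)); last by ring.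
by rewrite pmulr_rge0 // subr_ge0.
Qed.

(** By Cauchy-Schwarz on each row, the Frobenius norm is an upper bound.  This
    is what makes the supremum in [specnorm] a genuine one. *)
Lemma specnorm_has_ubound p q (B : 'M[R]_(p, q)) :
  has_ubound [set enorm (B *m x) | x in [set x : 'cV[R]_q | enorm x <= 1]].
Proof.
exists (Num.sqrt (\sum_i enorm (row i B)^T ^+ 2)) => _ [x /= x1 <-].
apply: ler_wsqrtr; apply: ler_sum => i _.
have -> : (B *m x) i 0 = ((row i B)^T^T *m x) 0 0.
  by rewrite trmxK -row_mul [in RHS]mxE.
have dot_le (z : 'cV[R]_q) : (z^T *m x) 0 0 <= enorm z.
  by apply: le_trans (dot_le_enormM _ _) _; rewrite ler_piMr ?enorm_ge0.
rewrite -real_normK ?num_real // lerXn2r ?nnegrE ?normr_ge0 ?enorm_ge0 //.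
rewrite ler_norml dot_le andbT lerNl.
have := dot_le (- (row i B)^T).
by rewrite linearN /= mulNmx mxE -scaleN1r enormZ normrN normr1 mul1r.
Qed.

Lemma specnorm_le p q (B : 'M[R]_(p, q)) (c : R) :
  (forall x, enorm x <= 1 -> enorm (B *m x) <= c) -> specnorm B <= c.
Proof.
move=> Bc; apply: ge_sup => [|_ [x /= x1 <-]]; last exact: Bc.
by exists (enorm (B *m 0)), 0 => //=; rewrite enorm0 ler01.
Qed.

Lemma specnorm_ge p q (B : 'M[R]_(p, q)) (x : 'cV[R]_q) :
  enorm x <= 1 -> enorm (B *m x) <= specnorm B.
Proof.
by move=> x1; apply: ub_le_sup; [exact: specnorm_has_ubound|exists x].
Qed.

Lemma specnorm_ge0 p q (B : 'M[R]_(p, q)) : 0 <= specnorm B.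
Proof. by have := @specnorm_ge _ _ B 0; rewrite mulmx0 !enorm0; exact. Qed.

Lemma enorm_mul_le p q (B : 'M[R]_(p, q)) (x : 'cV[R]_q) :
  enorm (B *m x) <= specnorm B * enorm x.
Proof.
have [->|x0] := eqVneq x 0; first by rewrite mulmx0 !enorm0 mulr0.
have x_gt0 : 0 < enorm x by rewrite lt_neqAle enorm_ge0 eq_sym enorm_eq0 x0.
rewrite -ler_pdivrMr // mulrC -[_^-1]ger0_norm ?invr_ge0 ?enorm_ge0 //.
rewrite -enormZ scalemxAr; apply: specnorm_ge.
by rewrite enormZ ger0_norm ?invr_ge0 ?enorm_ge0 // mulVf // gt_eqF.
Qed.

Lemma enorm_tr_mul_sqr p q (B : 'M[R]_(p, q)) (y : 'cV[R]_p) :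
  enorm (B^T *m y) ^+ 2 = (y^T *m (B *m B^T *m y)) 0 0.
Proof. by rewrite enorm_sqr_dot trmx_mul trmxK !mulmxA. Qed.

(** [|B^T y|^2 = <y, B (B^T y)> <= |y| |B| |B^T y|]. *)
Lemma specnorm_tr_le p q (B : 'M[R]_(p, q)) : specnorm B^T <= specnorm B.
Proof.
apply: specnorm_le => y y1; have [->|] := eqVneq (enorm (B^T *m y)) 0.
  exact: specnorm_ge0.
move=> nz; have gt0 : 0 < enorm (B^T *m y).
  by rewrite lt_neqAle eq_sym nz enorm_ge0.
rewrite -(ler_pM2r gt0) -expr2 enorm_tr_mul_sqr -mulmxA.
apply: le_trans (dot_le_enormM _ _) _; apply: le_trans (enorm_mul_le _ _).
by rewrite ler_piMl ?enorm_ge0.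
Qed.

(** The C*-identity: [<=] holds because
    [|B^T y|^2 = <y, B B^T y> <= |B B^T|] on the unit ball, and [>=] because the
    norm is submultiplicative and invariant under transposition. *)
Lemma specnorm_gram p q (B : 'M[R]_(p, q)) :
  specnorm B = Num.sqrt (specnorm (B *m B^T)).
Proof.
apply/eqP; rewrite eq_le; apply/andP; split.
  rewrite -[in leLHS](trmxK B); apply: le_trans (specnorm_tr_le _) _.
  apply: specnorm_le => y y1.
  rewrite -[leLHS]ger0_norm ?enorm_ge0 // -sqrtr_sqr; apply: ler_wsqrtr.
  rewrite enorm_tr_mul_sqr; apply: le_trans (dot_le_enormM _ _) _.
  apply: le_trans (specnorm_ge _ y1).
  by rewrite ler_piMl ?enorm_ge0.
rewrite -[leRHS]ger0_norm ?specnorm_ge0 // -sqrtr_sqr; apply: ler_wsqrtr.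
apply: specnorm_le => y y1; rewrite -mulmxA.
apply: le_trans (enorm_mul_le _ _) _; rewrite expr2 ler_wpM2l ?specnorm_ge0 //.
exact: le_trans (specnorm_ge _ y1) (specnorm_tr_le _).
Qed.

Lemma eq_specnorm_gram p q q' (B : 'M[R]_(p, q)) (C : 'M[R]_(p, q')) :
  B *m B^T = C *m C^T -> specnorm B = specnorm C.
Proof. by move=> BC; rewrite specnorm_gram BC -specnorm_gram. Qed.

End Norms.

(** * Kronecker products *)

Section Kronecker.
Context (R : comPzRingType).

Lemma tens_row_mxl m n1 n2 p q (A : 'M[R]_(m, n1)) (B : 'M[R]_(m, n2))
    (C : 'M[R]_(p, q)) :
  row_mx A B *t C
  = castmx (erefl, esym (mulnDl n1 n2 q)) (row_mx (A *t C) (B *t C)).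
Proof.
rewrite -[LHS](castmxK erefl (mulnDl n1 n2 q)); congr castmx.
apply/matrixP => i j.
rewrite castmxE /=; case: (mxtens_indexP i) => i0 i1.
case: (split_ordP j) => k -> {j}; case: (mxtens_indexP k) => k0 k1.
  rewrite row_mxEl tensmxE -(row_mxEl A B) cast_ord_id -tensmxE.
  by congr (tensmx _ _ _ _); apply: val_inj.
rewrite row_mxEr tensmxE -(row_mxEr A B) cast_ord_id -tensmxE.
by congr (tensmx _ _ _ _); apply: val_inj; rewrite /= mulnDl addnA.
Qed.

Lemma castmx_mul_tr m m' n n' p p' (em : m = m') (en : n = n') (ep : p = p')
    (A : 'M[R]_(m, n)) (B : 'M[R]_(p, n)) :
  castmx (em, en) A *m (castmx (ep, en) B)^T = castmx (em, ep) (A *m B^T).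
Proof. by case: m' / em; case: n' / en; case: p' / ep. Qed.

Lemma tens_row_col m n (x : 'cV[R]_n) (r : 'cV[R]_m) :
  castmx (mul1n m, muln1 n) (x^T *t r) = r *m x^T.
Proof.
apply/matrixP => i j; rewrite castmxE [RHS]mxE big_ord1 !mxE mulrC.
congr (r _ _ * x _ _); try exact: ord1; apply: val_inj => /=.
  by rewrite modn_small.
by rewrite divn1.
Qed.

End Kronecker.

(** * The two Gram matrices *)

Lemma mul_gram (R : comPzRingType) k p q (W : 'M[R]_(k, p)) (B : 'M[R]_(p, q)) :
  (W *m B) *m (W *m B)^T = W *m (B *m B^T) *m W^T.
Proof. by rewrite trmx_mul !mulmxA. Qed.

Section Gram.
Context (R : realType) (m n : nat).
Context (A : 'M[R]_(m, n)) (x : 'cV[R]_n) (r : 'cV[R]_m).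

Let H : 'M[R]_n :=
  (1 + enorm x ^+ 2) *: (A^T *m A) - A^T *m r *m x^T - x *m r^T *m A
  + (enorm r ^+ 2)%:M.

(** The matrix that sends [(vec E; f)] to [E x - f]. *)
Let L : 'M[R]_(m, n * m + m) :=
  castmx (mul1n m, stls_dim m n) (row_mx x^T (-1)%:M *t (1%:M : 'M[R]_m)).

(** The matrix that sends [(vec E; f)] to [E^T r]. *)
Let N : 'M[R]_(n, n * m + m) :=
  row_mx (castmx (muln1 n, erefl (n * m)%N) ((1%:M : 'M[R]_n) *t r^T))
         (0 : 'M[R]_(n, m)).

Let L_blocks :
  L = row_mx (castmx (mul1n m, erefl (n * m)%N) (x^T *t (1%:M : 'M[R]_m)))
             (- 1%:M).
Proof.
rewrite /L tens_row_mxl castmx_comp.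
rewrite (castmx_row (erefl (n * m)%N) (mul1n m)); congr row_mx.
  exact: eq_castmx.
rewrite tens_scalar_mx castmx_comp.
by rewrite (eq_castmx _ (erefl, erefl)) castmx_id scaleN1r.
Qed.

Let L_gram : L *m L^T = (1 + enorm x ^+ 2)%:M.
Proof.
rewrite L_blocks tr_row_mx mul_row_col castmx_mul_tr trmx_tens trmxK trmx1.
rewrite tensmx_mul mulmx1 mul_tr_self tens_scalar_mx castmx_comp.
rewrite (eq_castmx _ (erefl, erefl)) castmx_id.
rewrite linearN /= trmx1 mulNmx mulmxN opprK mulmx1.
by rewrite scalemx1 -raddfD addrC.
Qed.

Let N_gram : N *m N^T = (enorm r ^+ 2)%:M.
Proof.
rewrite tr_row_mx mul_row_col mul0mx addr0 castmx_mul_tr trmx_tens trmxK trmx1.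
rewrite tensmx_mul mulmx1 mul_tr_self tens_mx_scalar castmx_comp.
by rewrite (eq_castmx _ (erefl, erefl)) castmx_id scalemx1.
Qed.

Let L_N_tr : L *m N^T = r *m x^T.
Proof.
rewrite L_blocks tr_row_mx mul_row_col trmx0 mulmx0 addr0 castmx_mul_tr.
by rewrite trmx_tens trmxK trmx1 tensmx_mul mulmx1 mul1mx tens_row_col.
Qed.

Hypothesis r0 : r != 0.

Let s := enorm r ^+ 2.

Let s_neq0 : s != 0.
Proof. by rewrite sqrf_eq0 enorm_eq0. Qed.

(** [- A^T] times the Householder reflection that exchanges [r] and [- r], which
    explains [P_r] and [P_gram] below. *)
Let P : 'M[R]_(n, m) := (2 / s) *: (A^T *m r *m r^T) - A^T.

Let P_tr : P^T = (2 / s) *: (r *m (A^T *m r)^T) - A.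
Proof. by rewrite linearB linearZ /= trmx_mul !trmxK. Qed.

Let u_tr : (A^T *m r)^T = r^T *m A.
Proof. by rewrite trmx_mul trmxK. Qed.

Let P_r : P *m r = A^T *m r.
Proof.
rewrite mulmxBl -scalemxAl -(mulmxA _ r^T) mul_tr_self -/s.
by rewrite mul_mx_scalar scalerA divfK // scaler_nat mulr2n addrK.
Qed.

Let P_gram : P *m P^T = A^T *m A.
Proof.
rewrite P_tr mulmxBr -scalemxAr mulmxA P_r mulmxBl -scalemxAl u_tr !mulmxA.
by rewrite opprB addrCA subrr addr0.
Qed.

(** Expands to [P L L^T P^T - P L N^T - N L^T P^T + N N^T], where [L L^T] and
    [N N^T] are scalar, [L N^T = r x^T], [P P^T = A^T A] and [P r = A^T r]. *)
Lemma sensitivity_gram : (P *m L - N) *m (P *m L - N)^T = H.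
Proof.
have N_L_tr : N *m L^T = x *m r^T.
  by rewrite -[LHS]trmxK trmx_mul trmxK L_N_tr trmx_mul trmxK.
rewrite [(_ - _)^T]linearB /= trmx_mul mulmxBl !mulmxBr N_gram.
rewrite -(mulmxA P) (mulmxA L) L_gram -(mulmxA P L) L_N_tr (mulmxA N) N_L_tr.
rewrite mul_scalar_mx -scalemxAr P_gram (mulmxA P) P_r.
rewrite -(mulmxA x) -[r^T *m P^T]trmx_mul P_r u_tr mulmxA.
by rewrite opprB addrA addrAC.
Qed.

(** The terms in [A^T r r^T A] of the second and third blocks are
    [- |x|^2 / |r|^2] and [|r|^2 |x|^2 / |r|^4] times that matrix, and cancel. *)
Lemma projected_gram :
  let B := row_mx A^T
          (row_mx
             (enorm x *: (A^T *m (1%:M - (enorm r ^+ 2)^-1 *: (r *m r^T))))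
             (enorm r *: (1%:M - (enorm r ^+ 2)^-1 *: (A^T *m r *m x^T)))) in
  B *m B^T = H.
Proof.
move=> B; rewrite /B -/s; set u := A^T *m r.
have gramZ p q (a : R) (X : 'M[R]_(p, q)) :
    (a *: X) *m (a *: X)^T = a ^+ 2 *: (X *m X^T).
  by rewrite linearZ /= -scalemxAl -scalemxAr scalerA expr2.
have gram2 : let X := A^T *m (1%:M - s^-1 *: (r *m r^T)) in
    X *m X^T = A^T *m A - s^-1 *: (u *m u^T).
  rewrite /= mulmxBr mulmx1 -scalemxAr mulmxA -/u.
  rewrite [(_ - _)^T]linearB /= [(_ *: _)^T]linearZ /=.
  rewrite [(u *m _)^T]trmx_mul !trmxK.
  rewrite mulmxBl !mulmxBr.
  rewrite -!scalemxAl -!scalemxAr !mulmxA -(mulmxA u r^T r) mul_tr_self -/s.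
  rewrite -(mulmxA u r^T A) -u_tr -/u mul_mx_scalar -scalemxAl !scalerA.
  by rewrite mulVf // mulr1 subrr subr0.
have gram3 : let X := 1%:M - s^-1 *: (u *m x^T) in
    X *m X^T = 1%:M - s^-1 *: (u *m x^T) - s^-1 *: (x *m u^T)
               + (s^-1 ^+ 2 * enorm x ^+ 2) *: (u *m u^T).
  rewrite /= [(_ - _)^T]linearB /= [(_ *: _)^T]linearZ /= trmx1.
  rewrite [(u *m _)^T]trmx_mul trmxK mulmxBl !mulmxBr.
  rewrite !mul1mx mulmx1 -!scalemxAl -!scalemxAr !mulmxA.
  rewrite -(mulmxA u x^T x) mul_tr_self mul_mx_scalar -scalemxAl !scalerA.
  by rewrite opprB addrA addrAC mulrA -expr2 (addrAC 1%:M).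
rewrite !tr_row_mx !mul_row_col trmxK !gramZ gram2 gram3 /H -/s -/u.
rewrite -(mulmxA x) -u_tr -/u.
move: (A^T *m A) (u *m u^T) (u *m x^T) (x *m u^T) => G U V W.
by apply/matrixP => i j; rewrite !mxE -/s; field.
Qed.

End Gram.

(** * The condition number of scaled total least squares *)

Section STLS.
Context (R : realType) (m n : nat).
Context (A : 'M[R]_(m, n)) (b : 'cV[R]_m) (lambda : R).
Hypothesis r0 : stls_res A b lambda != 0.

Lemma tr_invmx_stls_M :
  (invmx (stls_M A b lambda))^T = invmx (stls_M A b lambda).
Proof. by rewrite trmx_inv linearB /= trmx_mul trmxK tr_scalar_mx. Qed.

Lemma kappaF_eq1 : kappaF A b lambda = kappaF1 A b lambda.
Proof.
rewrite /kappaF specnorm_gram /stls_K mul_gram sensitivity_gram //.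
by rewrite tr_invmx_stls_M.
Qed.

Lemma kappaF_eq2 : kappaF A b lambda = kappaF2 A b lambda.
Proof.
apply: eq_specnorm_gram.
by rewrite /stls_K !mul_gram sensitivity_gram // projected_gram.
Qed.

End STLS.

Theorem theorem2p3 (R : realType) (m n : nat) (hn : (1 <= n)%N) (hmn : (n < m)%N)
    (A : 'M[R]_(m, n)) (b : 'cV[R]_m) (lambda : R) (hlambda : 0 < lambda)
    (hsigma : min_singular_value (row_mx A (lambda *: b)) < min_singular_value A)
    (hr : stls_res A b lambda != 0) :
  kappaF A b lambda = kappaF1 A b lambda /\
  kappaF A b lambda = kappaF2 A b lambda.
Proof. by split; [exact: kappaF_eq1|exact: kappaF_eq2]. Qed.
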